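(* If $G=(V,E)$ is a finite simple undirected loopless graph that is either edge-transitive or distance-regular, then $$|E| = \eta(G)\,\eta^\circ(G).$$
   Context: Let $G=(V,E)$ be a finite simple undirected loopless graph with Laplacian $L=\sum_{ij\in E}(e_i-e_j)(e_i-e_j)^T$. For real matrices, $\langle X,Y\rangle=\operatorname{tr}(XY^T)$ is the trace inner product; $M\succcurlyeq 0$ means that the real symmetric matrix $M$ is positive semidefinite; $\mathrm{diag}(M)$ is the vector of diagonal entries; $\mathbb{1}$ is the all-ones vector. For a symmetric matrix $N$ indexed by $V$, $\mathcal{L}^*(N)\in\mathbb{R}^E$ is defined by $\mathcal{L}^*(N)_{ij}=N_{ii}+N_{jj}-2N_{ij}$ for $ij\in E$. Define $$\eta(G)=\max\{\tfrac14\langle L,M\rangle : M\succcurlyeq 0,\ \mathrm{diag}(M)=\mathbb{1}\},$$ $$\eta^\circ(G)=\min\{\mu : \mu\ge 0,\ N\succcurlyeq 0,\ \mathrm{diag}(N)=\mu\cdot\mathbb{1},\ \tfrac14\mathcal{L}^*(N)\ge\mathbb{1}\}.$$ A graph is edge-transitive if its automorphism group acts transitively on its edges. Distance-regular graphs are understood in the standard sense (connected, with the usual intersection numbers). *)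

(* Defs.v *)
From mathcomp Require Import all_boot all_order all_algebra all_fingroup.
From mathcomp Require Import boolp classical_sets reals.

Set Implicit Arguments.
Unset Strict Implicit.
Unset Printing Implicit Defensive.

Import Order.TTheory GRing.Theory Num.Theory.
Local Open Scope ring_scope.

Record sgraph (V : finType) := SGraph {
  adj :> rel V;
  adj_sym : symmetric adj;
  adj_irr : irreflexive adj
}.

Section Graph.
Context {V : finType} (G : sgraph V).

(* Each undirected edge is represented exactly once, by the ordered pair whose
   first endpoint comes first in the enumeration of V. *)
Definition edges : {set V * V} :=
  finset (fun p : V * V => G p.1 p.2 && (enum_rank p.1 < enum_rank p.2)%N).

Definition automorphism (s : {perm V}) : Prop :=
  forall x y, G (s x) (s y) = G x y.

(* Edges are unordered: s may send x to v and y to u. *)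
Definition edge_transitive : Prop :=
  forall x y u v, G x y -> G u v ->
    exists s : {perm V}, automorphism s /\
      ((s x = u /\ s y = v) \/ (s x = v /\ s y = u)).

Definition walk (x y : V) (k : nat) : bool :=
  [exists p : k.-tuple V, path G x p && (last x p == y)].

(* The length of a shortest walk; such a walk has fewer than #|V| steps.  The
   value is #|V| when y cannot be reached from x. *)
Definition dist (x y : V) : nat := find (walk x y) (iota 0 #|V|).

Definition connected_graph : Prop := forall x y, connect G x y.

(* b i and c i are the intersection numbers: for x, y at distance i, they count
   the neighbours of y at distance i + 1, resp. i - 1, from x. *)
Definition distance_regular : Prop :=
  connected_graph /\
  exists b c : nat -> nat, forall x y : V,
    #|[pred z | G y z & dist x z == (dist x y).+1]| = b (dist x y) /\
    #|[pred z | G y z & (dist x z).+1 == dist x y]| = c (dist x y).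

End Graph.

Section Semidefinite.
Context {R : realType}.

Definition inner m n (X Y : 'M[R]_(m, n)) : R := \tr (X *m Y^T).

Definition psd n (M : 'M[R]_n) : Prop :=
  M^T = M /\ forall x : 'cV[R]_n, 0 <= (x^T *m M *m x) 0 0.

Definition diag_of n (M : 'M[R]_n) : 'cV[R]_n := \col_i M i i.

Definition is_max (A : set R) (v : R) : Prop := A v /\ forall w, A w -> w <= v.

Definition is_min (A : set R) (v : R) : Prop := A v /\ forall w, A w -> v <= w.

(* The largest, resp. smallest, element of A; 0 if there is none. *)
Definition maximum (A : set R) : R := xget 0 (is_max A).
Definition minimum (A : set R) : R := xget 0 (is_min A).

End Semidefinite.

(* Matrices indexed by V are matrices of size #|V|, the vertex x having index
   enum_rank x. *)
Section Eta.
Context (R : realType) {V : finType} (G : sgraph V).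

Definition unit_vec (x : V) : 'cV[R]_#|V| := delta_mx (enum_rank x) 0.

Definition laplacian : 'M[R]_#|V| :=
  \sum_(p in edges G)
    (unit_vec p.1 - unit_vec p.2) *m (unit_vec p.1 - unit_vec p.2)^T.

Definition lstar (N : 'M[R]_#|V|) (x y : V) : R :=
  let i := enum_rank x in let j := enum_rank y in
  N i i + N j j - 2 * N i j.

Definition eta_values (v : R) : Prop :=
  exists M : 'M[R]_#|V|,
    [/\ psd M, diag_of M = const_mx 1 & v = 4^-1 * inner laplacian M].

Definition eta_polar_values (mu : R) : Prop :=
  0 <= mu /\
  exists N : 'M[R]_#|V|,
    [/\ psd N, diag_of N = mu *: const_mx 1 &
        forall p, p \in edges G -> 1 <= 4^-1 * lstar N p.1 p.2].

Definition eta : R := maximum eta_values.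
Definition eta_polar : R := minimum eta_polar_values.

End Eta.

(* Main.v *)
Require Import Defs.
From mathcomp Require Import all_boot all_order all_algebra.
From mathcomp Require Import reals.
From mathcomp Require Import all_fingroup boolp classical_sets.
From mathcomp Require Import topology normedtype derive ring lra.

(* By weak duality |E| <= mu * eta(G) for every polar feasible mu.  If some
   maximizer M of eta(G) has L^*(M) constant on the edges, then that constant is
   4 eta(G) / |E|, so (|E| / eta(G)) M is polar feasible and equality holds.  For
   an edge-transitive graph, average any maximizer over the automorphism group.
   For a distance-regular graph, let theta be the least eigenvalue of the
   adjacency matrix A and (X - theta) r its minimal polynomial: r(A)^2 is psd,
   and like every polynomial in A its entries depend only on the distance, so a
   multiple of it has unit diagonal and is constant on the edges; it is optimal
   because <L, M> = 2|E| - tr(A M) and A - theta I is psd. *)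

Set Implicit Arguments.
Unset Strict Implicit.
Unset Printing Implicit Defensive.

Import Order.TTheory GRing.Theory Num.Theory.
Import numFieldNormedType.Exports.
Local Open Scope ring_scope.

(** * Positive semidefinite matrices and their quadratic forms *)

Section PsdTheory.
Context {R : realType}.

Lemma quad_formE n (M : 'M[R]_n) (x y : 'cV[R]_n) :
  (x^T *m M *m y) 0 0 = \sum_i \sum_j x i 0 * M i j * y j 0.
Proof.
rewrite -mulmxA mxE; apply: eq_bigr => i _; rewrite !mxE mulr_sumr.
by apply: eq_bigr => j _; rewrite mulrA.
Qed.

Lemma quad_form_delta n (M : 'M[R]_n) i j :
  ((delta_mx i 0 : 'cV[R]_n)^T *m M *m (delta_mx j 0 : 'cV[R]_n)) 0 0 = M i j.
Proof. by rewrite trmx_delta -rowE -colE !mxE. Qed.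

Lemma quad_form_sym n (M : 'M[R]_n) (x y : 'cV[R]_n) : M^T = M ->
  (y^T *m M *m x) 0 0 = (x^T *m M *m y) 0 0.
Proof.
move=> Ms; have -> : x^T *m M *m y = (y^T *m M *m x)^T.
  by rewrite !trmx_mul trmxK Ms mulmxA.
by rewrite [RHS]mxE.
Qed.

Lemma quad_formD n (M : 'M[R]_n) (x y : 'cV[R]_n) (a : R) : M^T = M ->
  ((a *: x + y)^T *m M *m (a *: x + y)) 0 0 =
  a ^+ 2 * (x^T *m M *m x) 0 0 + a *+ 2 * (y^T *m M *m x) 0 0
  + (y^T *m M *m y) 0 0.
Proof.
move=> Ms; have -> : (a *: x + y)^T = a *: x^T + y^T.
  by apply/matrixP => i j; rewrite !mxE.
have addE (X Y : 'M[R]_1) : (X + Y) 0 0 = X 0 0 + Y 0 0 by rewrite mxE.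
have scaleE b (X : 'M[R]_1) : (b *: X) 0 0 = b * X 0 0 by rewrite mxE.
rewrite !mulmxDl !mulmxDr -!scalemxAl -!scalemxAr !(addE, scaleE).
by rewrite (quad_form_sym y x Ms); ring.
Qed.

Lemma psd_congr m n (P : 'M[R]_(m, n)) (M : 'M[R]_n) :
  psd M -> psd (P *m M *m P^T).
Proof.
case=> Ms M0; split=> [|x]; first by rewrite !trmx_mul trmxK Ms mulmxA.
by have := M0 (P^T *m x); rewrite trmx_mul trmxK !mulmxA.
Qed.

Lemma psd_mxsub m n (f : 'I_m -> 'I_n) (M : 'M[R]_n) :
  psd M -> psd (mxsub f f M).
Proof.
move=> Mp; have -> : mxsub f f M = rowsub f 1%:M *m M *m (rowsub f 1%:M)^T.
  by rewrite trmx_mxsub trmx1 -rowsubE -mxsub_mul mulmx1.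
exact: psd_congr.
Qed.

Lemma psd1 n : psd (1%:M : 'M[R]_n).
Proof.
split=> [|x]; first by rewrite trmx1.
by rewrite mulmx1 mxE; apply: sumr_ge0 => i _; rewrite !mxE -expr2 sqr_ge0.
Qed.

Lemma psd_sqr n (X : 'M[R]_n) : X^T = X -> psd (X *m X).
Proof. by move=> Xs; have := psd_congr X (psd1 n); rewrite Xs mulmx1. Qed.

Lemma psdZ n (a : R) (M : 'M[R]_n) : 0 <= a -> psd M -> psd (a *: M).
Proof.
move=> a0 [Ms M0]; split=> [|x]; first by rewrite linearZ /= Ms.
by rewrite -scalemxAr -scalemxAl mxE mulr_ge0.
Qed.

Lemma psd_sum n (I : finType) (P : pred I) (F : I -> 'M[R]_n) :
  (forall i, P i -> psd (F i)) -> psd (\sum_(i | P i) F i).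
Proof.
move=> PF; split=> [|x].
  by rewrite linear_sum; apply: eq_bigr => i /PF[].
rewrite mulmx_sumr mulmx_suml summxE; apply: sumr_ge0 => i /PF[_]; exact.
Qed.

(** Along [t x + e_i] the form is affine in [t] with slope [2 (M x)_i], so it would become negative
    somewhere unless the slope is zero. *)
Lemma psd_ker n (M : 'M[R]_n) (x : 'cV[R]_n) :
  psd M -> (x^T *m M *m x) 0 0 = 0 -> M *m x = 0.
Proof.
move=> [Ms M0] Mx; apply/colP => i; rewrite [RHS]mxE; set c := LHS.
pose y : 'cV[R]_n := delta_mx i 0.
have yx : (y^T *m M *m x) 0 0 = c.
  by rewrite trmx_delta -mulmxA -rowE [LHS]mxE.
apply/eqP/negPn/negP => c0.
(* This coefficient of [x] makes the form equal to [-(M i i + 1) + M i i = -1]. *)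
have := M0 (- (M i i + 1) / (c *+ 2) *: x + y).
rewrite quad_formD // Mx yx (quad_form_delta M i i).
have -> : (- (M i i + 1) / (c *+ 2)) *+ 2 * c = - (M i i + 1) by field.
by rewrite mulr0 add0r; lra.
Qed.

Lemma psd_diag_ge0 n (M : 'M[R]_n) i : psd M -> 0 <= M i i.
Proof. by case=> _ /(_ (delta_mx i 0)); rewrite quad_form_delta. Qed.

Lemma psd_diag_eq0 n (M : 'M[R]_n) i j : psd M -> M i i = 0 -> M i j = 0.
Proof.
move=> Mp Mii.
have /colP/(_ j) : M *m (delta_mx i 0 : 'cV_n) = 0.
  by apply: psd_ker => //; rewrite quad_form_delta.
by rewrite -colE !mxE; case: Mp => {2}<- _; rewrite mxE.
Qed.

(** Evaluate the form at [e_j + e_i] and [e_j - e_i]. On a constant diagonal this bounds every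
    entry. *)
Lemma psd_offdiag_le n (M : 'M[R]_n) i j : psd M ->
  `|M i j| *+ 2 <= M i i + M j j.
Proof.
case=> Ms M0.
have H a : 0 <= a ^+ 2 * M i i + a *+ 2 * M j i + M j j.
  have := M0 (a *: delta_mx i 0 + delta_mx j 0).
  by rewrite quad_formD // !quad_form_delta.
have Mji : M j i = M i j by rewrite -{1}Ms mxE.
have := H 1; have := H (-1); rewrite Mji.
by case: (ger0P (M i j)); lra.
Qed.

(* Subtracting [B e_i e_i^T B / B_ii] keeps a psd matrix psd and clears its
   i-th diagonal entry, so a psd matrix is a finite sum of matrices [u u^T]. *)
Lemma psd_tr_mul_ge0 n (B M : 'M[R]_n) : psd B -> psd M -> 0 <= \tr (B *m M).
Proof.
(* Induction on the number of nonzero diagonal entries of [B]. *)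
move=> + Mp; have [k] := ubnP #|[pred i | B i i != 0]|.
elim: k B => // k IHk B ltBk Bp.
have [[i Bii]|B0] := pselect (exists i, B i i != 0); last first.
  suff -> : B = 0 by rewrite mul0mx linear0.
  apply/matrixP => i j; rewrite [RHS]mxE; apply: psd_diag_eq0 => //.
  by apply/eqP/negPn/negP => Bii; apply: B0; exists i.
pose e : 'cV[R]_n := delta_mx i 0; pose u := B *m e.
have [Bs _] := Bp.
have uT : u^T = e^T *m B by rewrite trmx_mul Bs.
have eBe : e^T *m B *m e = (B i i)%:M.
  by apply/matrixP => a b; rewrite !ord1 quad_form_delta !mxE eqxx mulr1n.
pose B' := B - (B i i)^-1 *: (u *m u^T).
have B'p : psd B'.
  (* [B'] is a congruence of [B]: the left factor already turns [B] into [B'], and the right one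
     changes nothing because [B' e = 0]. *)
  have := psd_congr (1%:M - (B i i)^-1 *: (u *m e^T)) Bp; congr psd.
  have -> : (1%:M - (B i i)^-1 *: (u *m e^T)) *m B = B'.
    by rewrite mulmxBl mul1mx -scalemxAl -mulmxA -uT.
  have B'e : B' *m e = 0.
    rewrite mulmxBl -scalemxAl -mulmxA uT eBe mul_mx_scalar.
    by rewrite scalerA mulVf // scale1r subrr.
  rewrite linearB linearZ /= trmx1 trmx_mul trmxK mulmxBr mulmx1.
  by rewrite -scalemxAr mulmxA B'e mul0mx scaler0 subr0.
have B'i j : B' j j = B j j - (B i i)^-1 * B i j ^+ 2.
  have Bji : B j i = B i j by rewrite -{1}Bs mxE.
  by rewrite /B' /u -colE !mxE big_ord1 !mxE Bji expr2.
have -> : B = B' + (B i i)^-1 *: (u *m u^T) by rewrite subrK.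
have -> : \tr ((B' + (B i i)^-1 *: (u *m u^T)) *m M) =
    \tr (B' *m M) + (B i i)^-1 * (u^T *m M *m u) 0 0.
  rewrite mulmxDl mxtraceD -scalemxAl mxtraceZ -mulmxA
    [\tr (u *m _)]mxtrace_mulC.
  by rewrite [\tr (u^T *m M *m u)]/mxtrace big_ord1.
rewrite addr_ge0 //.
  apply: IHk => //; rewrite -ltnS; apply: leq_trans ltBk.
  (* Zero diagonal entries of [B] stay zero, since their whole row vanishes, and the [i]-th one
     becomes zero. *)
  rewrite ltnS; apply: proper_card; apply/properP; split.
    apply/fintype.subsetP => j; rewrite !inE; apply: contraNN => /eqP Bjj.
    have Bji : B i j = 0.
      by rewrite -Bs mxE; apply: psd_diag_eq0.
    by rewrite B'i Bjj Bji expr0n mulr0 subr0.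
  by exists i; rewrite !inE // B'i expr2 mulKf // subrr eqxx.
rewrite mulr_ge0 //; last exact: Mp.2.
by rewrite invr_ge0 psd_diag_ge0.
Qed.

Lemma diag_of_constP n (M : 'M[R]_n) (a : R) :
  diag_of M = const_mx a <-> forall i, M i i = a.
Proof.
split=> [/colP Ma i|Ma]; first by have := Ma i; rewrite [LHS]mxE [RHS]mxE.
by apply/colP => i; rewrite [LHS]mxE [RHS]mxE.
Qed.

End PsdTheory.

(** * Extrema attained by compactness, and the minimal polynomial *)

Section Extrema.
Context {R : realType}.

Lemma closed_forall (T : topologicalType) J (P : J -> T -> Prop) :
  (forall i, closed [set x | P i x]%classic) ->
  closed [set x | forall i, P i x]%classic.
Proof.
move=> Pc.
rewrite (_ : mkset _ = \bigcap_(i in [set: J]) [set x | P i x])%classic.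
  exact: closed_bigI.
by apply/seteqP; split=> x /= Px i; [move=> _; exact: Px | exact: (Px i I)].
Qed.

Lemma closed_ge0 (T : topologicalType) (f : T -> R) :
  continuous f -> closed [set x | 0 <= f x]%classic.
Proof.
move=> fc; apply: (preimage_closed (f := f) (D := [set y | 0 <= y]%classic)).
  by move=> x _; exact: fc.
exact: closed_ge.
Qed.

Lemma closed_eqr (T : topologicalType) (f : T -> R) (a : R) :
  continuous f -> closed [set x | f x = a]%classic.
Proof.
move=> fc; apply: (preimage_closed (f := f) (D := [set y | y = a]%classic)).
  by move=> x _; exact: fc.
exact: closed_eq.
Qed.

Lemma continuous_sum (T : topologicalType) (I : finType) (F : I -> T -> R) :
  (forall i, continuous (F i)) -> continuous (fun x => \sum_i F i x).
Proof. by move=> Fc; apply: continuous_big => //; exact: add_continuous. Qed.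

Lemma continuous_mul (T : topologicalType) (f g : T -> R) :
  continuous f -> continuous g -> continuous (fun x => f x * g x).
Proof. by move=> fc gc x; apply: continuousM; [exact: fc | exact: gc]. Qed.

Lemma closed_box_compact n (A : set 'rV[R]_n) :
  closed A -> (forall v, A v -> forall i, `|v 0 i| <= 1) -> compact A.
Proof.
move=> Ac Ab.
have boxc : compact [set v : 'rV[R]_n |
    forall i, `[-1, 1]%classic (v ord0 i)]%classic.
  apply: (@rV_compact R n (fun=> `[-1, 1]%classic)) => _.
  exact: segment_compact.
apply: subclosed_compact Ac boxc _ => v /Ab vb i.
by rewrite /= in_itv /= -ler_norml.
Qed.

(** [theta] is the minimum of the quadratic form on the unit sphere. At a minimizer [v] the form of
    [A - theta] vanishes, so [psd_ker] makes [v] an eigenvector. *)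
Lemma min_eigenvalue n (A : 'M[R]_n.+1) : A^T = A ->
  exists2 theta, psd (A - theta%:M) & eigenvalue A theta.
Proof.
move=> As.
pose S : set 'rV[R]_n.+1 := [set v | \sum_i v 0 i * v 0 i = 1]%classic.
pose f (v : 'rV[R]_n.+1) : R := \sum_i \sum_j v 0 i * A i j * v 0 j.
have fE (v : 'rV[R]_n.+1) : f v = (v *m A *m v^T) 0 0.
  have := quad_formE A v^T v^T; rewrite trmxK => ->; apply: eq_bigr => i _.
  by apply: eq_bigr => j _; rewrite !mxE.
have S0 : (S !=set0)%classic.
  exists (delta_mx 0 0); rewrite /S /= (bigD1 0) //= !mxE eqxx mulr1.
  by rewrite big1 ?addr0 // => i i0; rewrite !mxE (negPf i0) mulr0.
have Sc : compact S.
  apply: closed_box_compact.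
    apply: closed_eqr; apply: continuous_sum => i.
    by apply: continuous_mul; exact: coord_continuous.
  move=> v; rewrite /S /= => v1 i.
  have : v 0 i * v 0 i <= 1.
    rewrite -v1 (bigD1 i) //= lerDl; apply: sumr_ge0 => j _.
    by rewrite -expr2 sqr_ge0.
  by case: (ger0P (v 0 i)); nra.
have fc : continuous f.
  apply: continuous_sum => i; apply: continuous_sum => j.
  apply: continuous_mul; last exact: coord_continuous.
  by apply: continuous_mul; [exact: coord_continuous | exact: cst_continuous].
have [v vS vmin] := EVT_min_rV S0 Sc (continuous_subspaceT fc).
move: vS; rewrite inE /S /= => v1.
have vv : v *m v^T = 1%:M.
  apply/matrixP => a b; rewrite !ord1 !mxE eqxx -v1.
  by apply: eq_bigr => i _; rewrite !mxE.
have subE (X Y : 'M[R]_1) : (X - Y) 0 0 = X 0 0 - Y 0 0 by rewrite !mxE.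
have scaleE a (X : 'M[R]_1) : (a *: X) 0 0 = a * X 0 0 by rewrite mxE.
have scalar_mx00 (a : R) : (a%:M : 'M_1) 0 0 = a by rewrite mxE eqxx.
have Bp : psd (A - (f v)%:M).
  split=> [|x]; first by rewrite linearB /= As tr_scalar_mx.
  pose s := \sum_i x i 0 * x i 0.
  have xx : x^T *m x = s%:M.
    apply/matrixP => a b; rewrite !ord1 !mxE eqxx.
    by apply: eq_bigr => i _; rewrite !mxE.
  have [x0|x0] := eqVneq x 0; first by rewrite x0 mulmx0 mxE.
  have s0 : 0 < s.
    have [i xi] : exists i, x i 0 != 0.
      by apply/existsP; apply: contraNT x0; rewrite negb_exists => /forallP x0;
        apply/eqP/colP => i; rewrite mxE; apply/eqP; move: (x0 i); rewrite negbK.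
    rewrite /s (bigD1 i) //= ltr_pwDl //; first by rewrite -expr2 exprn_even_gt0.
    by apply: sumr_ge0 => j _; rewrite -expr2 sqr_ge0.
  (* Scaling [x] to unit length reduces the claim to the minimality of [f v]. *)
  pose w : 'rV[R]_n.+1 := (Num.sqrt s)^-1 *: x^T.
  have sqrts : (Num.sqrt s)^-1 * (Num.sqrt s)^-1 = s^-1.
    by rewrite -invfM -expr2 sqr_sqrtr // ltW.
  have : f v <= f w.
    apply: vmin; rewrite inE /S /=.
    under eq_bigr do rewrite !mxE mulrACA sqrts.
    by rewrite -mulr_sumr -/s mulVf // gt_eqF.
  rewrite (fE w) /w linearZ /= trmxK -!scalemxAl -scalemxAr scalerA sqrts.
  rewrite mulmxBr mulmxBl mul_mx_scalar -scalemxAl xx !(subE, scaleE).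
  rewrite scalar_mx00.
  by rewrite ler_pdivlMl // mulrC subr_ge0.
exists (f v) => //; apply/eigenvalueP; exists v; last first.
  apply/eqP => v0; move: vv; rewrite v0 mul0mx => /matrixP/(_ 0 0)/eqP.
  by rewrite !mxE eqxx eq_sym oner_eq0.
have : (A - (f v)%:M) *m v^T = 0.
  apply: psd_ker => //; rewrite trmxK mulmxBr mulmxBl mul_mx_scalar -scalemxAl.
  by rewrite vv subE scaleE -fE scalar_mx00 mulr1 subrr.
move/(congr1 trmx); rewrite trmx_mul trmxK linearB /= As tr_scalar_mx trmx0.
by rewrite mulmxBr mul_mx_scalar => /eqP; rewrite subr_eq0 => /eqP.
Qed.

(** [K] is the feasible set flattened into row vectors. It is cut out by closed conditions on the
    coordinates and bounded by [psd_offdiag_le], so a linear functional attains its maximum on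
    it. *)
Lemma elliptope_argmax n (L : 'M[R]_n) :
  exists M : 'M[R]_n, [/\ psd M, diag_of M = const_mx 1 &
    forall M', psd M' -> diag_of M' = const_mx 1 -> inner L M' <= inner L M].
Proof.
pose K : set 'rV[R]_(n * n) :=
  ([set v | forall i j, vec_mx v i j - vec_mx v j i = 0 :> R] `&`
   [set v | forall x : 'cV[R]_n,
      0 <= \sum_i \sum_j x i 0 * vec_mx v i j * x j 0] `&`
   [set v | forall i, vec_mx v i i = 1 :> R])%classic.
have KE v : K v <-> psd (vec_mx v) /\ diag_of (vec_mx v) = const_mx 1.
  split=> [[[/= vs v0] v1]|[[vs v0] v1]].
    split; last exact/diag_of_constP.
    split=> [|x]; last by rewrite quad_formE.
    by apply/matrixP => i j; rewrite [LHS]mxE; apply/eqP; rewrite -subr_eq0 vs.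
  split; [split|] => /=.
  - by move=> i j; rewrite -{1}vs [X in X - _]mxE subrr.
  - by move=> x; rewrite -quad_formE.
  - by apply/diag_of_constP.
have coordc i j : continuous (fun v : 'rV[R]_(n * n) => vec_mx v i j : R).
  rewrite (_ : (fun _ => _) = fun v : 'rV[R]_(n * n) => v 0 (mxvec_index i j)).
    exact: coord_continuous.
  by apply/funext => v; rewrite mxE.
have Kc : compact K.
  apply: closed_box_compact.
    apply: closedI; first apply: closedI.
    - apply: closed_forall => i; apply: closed_forall => j.
      by apply: closed_eqr => v; apply: continuousB; exact: coordc.
    - apply: closed_forall => x; apply: closed_ge0.
      apply: continuous_sum => i; apply: continuous_sum => j.
      apply: continuous_mul; last exact: cst_continuous.
      by apply: continuous_mul; [exact: cst_continuous | exact: coordc].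
    - by apply: closed_forall => i; exact: closed_eqr.
  move=> v /KE[vp /diag_of_constP v1] k; case/mxvec_indexP: k => i j.
  have := psd_offdiag_le i j vp.
  by rewrite !v1 mxE; lra.
have K0 : (K !=set0)%classic.
  exists (mxvec 1%:M); apply/KE; rewrite mxvecK; split; first exact: psd1.
  by apply/diag_of_constP => i; rewrite mxE eqxx.
pose f (v : 'rV[R]_(n * n)) : R := \sum_i \sum_j L i j * vec_mx v i j.
have fE v : inner L (vec_mx v) = f v.
  by apply: eq_bigr => i _; rewrite mxE; apply: eq_bigr => j _; rewrite mxE.
have fc : continuous f.
  apply: continuous_sum => i; apply: continuous_sum => j.
  by apply: continuous_mul; [exact: cst_continuous | exact: coordc].
have [v vK vmax] := EVT_max_rV K0 Kc (continuous_subspaceT fc).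
move: vK; rewrite inE => /KE[vp v1]; exists (vec_mx v); split=> // M' Mp M1.
rewrite -[M']mxvecK !fE; apply: vmax; rewrite inE; apply/KE.
by rewrite mxvecK.
Qed.

(** [r] is the minimal polynomial divided by [X - theta]: its degree is too small to annihilate [A],
    yet [(A - theta) r(A) = 0]. *)
Lemma mxminpoly_root_factor n (A : 'M[R]_n.+1) theta : eigenvalue A theta ->
  exists2 r : {poly R}, horner_mx A r != 0
    & A *m horner_mx A r = theta *: horner_mx A r.
Proof.
rewrite eigenvalue_root_min => /factor_theorem[r rE]; exists r.
  apply/eqP => /mxminpoly_min; rewrite rE.
  have r0 : r != 0.
    by apply: contraNneq (monic_neq0 (mxminpoly_monic A)) => r0;
      rewrite rE r0 mul0r.
  move=> /(dvdp_leq r0); rewrite size_Mmonic ?monicXsubC //.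
  by rewrite size_XsubC addn2 ltnn.
have := mx_root_minpoly A; rewrite rE mulrC rmorphM rmorphB /= horner_mx_X.
rewrite horner_mx_C => /eqP; rewrite mulrBl subr_eq0 => /eqP.
by rewrite -mul_scalar_mx.
Qed.

End Extrema.

(** * A psd polynomial in [A] supported on the least eigenspace *)

Section LeastEigenspace.
Context {R : realType}.

Lemma trmx_horner n (A : 'M[R]_n.+1) (p : {poly R}) :
  A^T = A -> (horner_mx A p)^T = horner_mx A p.
Proof.
move=> As; elim/poly_ind: p => [|p c IHp]; first by rewrite rmorph0 trmx0.
rewrite rmorphD rmorphM /= horner_mx_X horner_mx_C linearD /= tr_scalar_mx.
rewrite trmx_mul As IHp; congr (_ + _).
exact/esym/comm_horner_mx.
Qed.

(** The closure conditions put every polynomial in [A] into [S], in particular [P = r(A)^2] with [r]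
    the cofactor of the least eigenvalue. *)
Lemma least_eigenspace_psd n (A : 'M[R]_n) (S : 'M[R]_n -> Prop) :
  (0 < n)%N -> A^T = A -> (forall a, S a%:M) ->
  (forall X Y, S X -> S Y -> S (X + Y)) -> (forall X, S X -> S (X *m A)) ->
  exists theta P, [/\ S P, psd P, exists i, 0 < P i i,
    psd (A - theta%:M) & A *m P = theta *: P].
Proof.
case: n A S => // n A S _ As Sscal SD SA.
have Shorner p : S (horner_mx A p).
  elim/poly_ind: p => [|p c IHp]; first by rewrite -polyC0 horner_mx_C.
  rewrite rmorphD rmorphM /= horner_mx_X horner_mx_C.
  by apply: SD => //; exact: SA.
have [theta Bp /mxminpoly_root_factor[r]] := min_eigenvalue As.
set X := horner_mx A r => X0 AX.
have Xs : X^T = X by exact: trmx_horner.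
exists theta, (X *m X); split=> //.
- have -> : X *m X = horner_mx A (r * r) by rewrite rmorphM.
  exact: Shorner.
- exact: psd_sqr.
- have [i [j Xij]] : exists i j, X i j != 0.
    apply: contrapT => Xn; move/eqP: X0; apply.
    apply/matrixP => i j; rewrite [RHS]mxE; apply: contrapT => Xij.
    by apply: Xn; exists i, j; exact/eqP.
  (* As [X] is symmetric, a diagonal entry of its square is the sum of the squares of a row. *)
  exists i; rewrite mxE (bigD1 j) //= -{2}Xs [_^T _ _]mxE.
  rewrite ltr_pwDl //; first by rewrite -expr2 exprn_even_gt0.
  apply: sumr_ge0 => k _; rewrite -{2}Xs [_^T _ _]mxE.
  by rewrite -expr2 sqr_ge0.
- by rewrite mulmxA AX scalemxAl.
Qed.

End LeastEigenspace.

(** * The Laplacian as a sum over edges, and duality *)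

Section Duality.
Context {R : realType} {V : finType} (G : sgraph V).
Implicit Types M N : 'M[R]_#|V|.

(** Split the ordered adjacent pairs by rank order: one half is [edges], swapping endpoints carries
    the other onto it, and ties would be loops. *)
Lemma sum_edges (g : V -> V -> R) : (forall x y, g x y = g y x) ->
  (\sum_(p in edges G) g p.1 p.2) *+ 2 = \sum_x \sum_(y | G x y) g x y.
Proof.
move=> gs; rewrite pair_big_dep /=.
rewrite [RHS](bigID (fun p => enum_rank p.1 < enum_rank p.2)%N) /= mulr2n.
congr (_ + _); first by apply: eq_bigl => p; rewrite inE.
rewrite (reindex_inj (can_inj (@swap_pairK V V))) /=.
apply: eq_big => [[x y]|[x y] _] /=; last exact: gs.
rewrite inE /= adj_sym -leqNgt; case Gxy: (G x y) => //=.
rewrite ltn_neqAle; case: eqP => // /val_inj/enum_rank_inj yx.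
by rewrite yx adj_irr in Gxy.
Qed.

Lemma lstar_sym M x y : M^T = M -> lstar M x y = lstar M y x.
Proof. by move=> Ms; rewrite /lstar -{3}Ms mxE; ring. Qed.

Lemma lstarZ a M x y : lstar (a *: M) x y = a * lstar M x y.
Proof. by rewrite /lstar !mxE; ring. Qed.

Lemma lstar_diag a M x y : (forall i, M i i = a) ->
  lstar M x y = 2 * a - 2 * M (enum_rank x) (enum_rank y).
Proof. by move=> Ma; rewrite /lstar !Ma; ring. Qed.

Lemma innerZr m n a (X Y : 'M[R]_(m, n)) : inner X (a *: Y) = a * inner X Y.
Proof. by rewrite /inner linearZ /= -scalemxAr mxtraceZ. Qed.

Lemma inner_sumr m n (I : finType) (P : pred I) (X : 'M[R]_(m, n)) F :
  inner X (\sum_(i | P i) F i) = \sum_(i | P i) inner X (F i).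
Proof. by rewrite /inner linear_sum mulmx_sumr linear_sum. Qed.

(** By cyclicity of the trace an edge contributes [d^T M d] with [d = e_x - e_y]. *)
Lemma inner_laplacian M : M^T = M ->
  inner (laplacian R G) M = \sum_(p in edges G) lstar M p.1 p.2.
Proof.
move=> Ms; rewrite /inner /laplacian mulmx_suml linear_sum /=.
apply: eq_bigr => -[x y] _ /=; set d := _ - _.
rewrite Ms -mulmxA mxtrace_mulC [LHS]big_ord1.
have -> : d = (-1) *: unit_vec R y + unit_vec R x by rewrite scaleN1r addrC.
rewrite quad_formD // !quad_form_delta /lstar.
by ring.
Qed.

(** Ordered pairs erase the chosen orientation of the edges, which automorphisms may reverse. *)
Lemma inner_laplacian_pairs M : M^T = M ->
  inner (laplacian R G) M *+ 2 = \sum_x \sum_(y | G x y) lstar M x y.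
Proof.
move=> Ms; rewrite inner_laplacian // sum_edges // => x y.
exact: lstar_sym.
Qed.

Lemma is_max_maximum (A : set R) v : is_max A v -> maximum A = v.
Proof.
move=> Av; apply: xget_unique => // w [Aw wmax].
by apply/eqP; rewrite eq_le wmax ?Av.2 //; exact: Av.1.
Qed.

Lemma is_min_minimum (A : set R) v : is_min A v -> minimum A = v.
Proof.
move=> Av; apply: xget_unique => // w [Aw wmin].
by apply/eqP; rewrite eq_le wmin ?Av.2 //; exact: Av.1.
Qed.

Definition elliptope_max M : Prop := [/\ psd M, diag_of M = const_mx 1 &
  forall M', psd M' -> diag_of M' = const_mx 1 ->
    inner (laplacian R G) M' <= inner (laplacian R G) M].

(* Rescaling the maximizer turns it into a feasible point of the polar program,
   which weak duality shows to be optimal. *)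
Lemma eta_mul_polar M : elliptope_max M ->
  (forall p q, p \in edges G -> q \in edges G ->
     lstar M p.1 p.2 = lstar M q.1 q.2) ->
  #|edges G|%:R = eta R G * eta_polar R G.
Proof.
move=> [Mp M1 Mmax] Mconst; set e := 4^-1 * inner (laplacian R G) M.
have [Ms _] := Mp.
have etaE : eta R G = e.
  apply: is_max_maximum; split; first by exists M.
  by move=> _ [M' [M'p M'1 ->]]; rewrite ler_pM2l ?invr_gt0 //; exact: Mmax.
(* Without edges [eta] is zero, so both sides vanish whatever [eta_polar] is. *)
have [E0|[p0 Ep0]] := set_0Vmem (edges G).
  by rewrite etaE /e inner_laplacian // E0 cards0 big_set0 mulr0 mul0r.
have E_gt0 : 0 < #|edges G|%:R :> R.
  by rewrite ltr0n card_gt0; apply/set0Pn; exists p0.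
have innerM : inner (laplacian R G) M = #|edges G|%:R * lstar M p0.1 p0.2.
  rewrite inner_laplacian // mulr_natl -sumr_const.
  by apply: eq_bigr => p Ep; exact: Mconst.
have e_gt0 : 0 < e.
  rewrite /e mulr_gt0 ?invr_gt0 //.
  (* The identity is feasible and gives 2 on every edge, so the maximum is positive. *)
  have I1 : diag_of (1%:M : 'M[R]_#|V|) = const_mx 1.
    by apply/diag_of_constP => i; rewrite mxE eqxx.
  apply: lt_le_trans (Mmax _ (psd1 _) I1).
  rewrite inner_laplacian ?trmx1 // (eq_bigr (fun=> 2)).
    by rewrite sumr_const -[X in 0 < X]mulr_natl mulr_gt0.
  move=> [x y]; rewrite inE /= => /andP[_ xy].
  by rewrite /lstar !mxE !eqxx -val_eqE /= ltn_eqF // mulr0 subr0.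
rewrite etaE (_ : eta_polar R G = #|edges G|%:R / e); first
  by rewrite mulrCA mulfV ?mulr1 ?gt_eqF.
apply: is_min_minimum; split.
  split; first by rewrite divr_ge0 // ltW.
  exists ((#|edges G|%:R / e) *: M); split.
  - by apply: psdZ => //; rewrite divr_ge0 // ltW.
  - rewrite scalemx_const mulr1; apply/diag_of_constP => i.
    by move/diag_of_constP: M1 => M1; rewrite mxE M1 mulr1.
  (* If [c] is the common edge value, then [e = |E| c / 4], so every edge constraint is tight. *)
  - move=> p Ep; rewrite lstarZ (Mconst p p0) //.
    move: e_gt0; rewrite /e innerM => e_gt0.
    have c_gt0 : 0 < lstar M p0.1 p0.2.
      by move: e_gt0; rewrite !pmulr_rgt0 ?invr_gt0.
    rewrite le_eqVlt; apply/orP; left; apply/eqP; field.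
    by rewrite !gt_eqF.
move=> mu [mu0 [N [Np Nmu Nge]]]; rewrite ler_pdivrMr //.
have [Ns _] := Np.
have Nd i : N i i = mu.
  by move: i; apply/diag_of_constP; rewrite Nmu scalemx_const mulr1.
(* If [mu] were zero, all entries of [N] on an edge would vanish, against its constraint. *)
have mu_gt0 : 0 < mu.
  have := Nge _ Ep0; rewrite (lstar_diag _ _ Nd).
  have := psd_offdiag_le (enum_rank p0.1) (enum_rank p0.2) Np; rewrite !Nd.
  by clear -mu0; case: ger0P; lra.
(* Weak duality: [N / mu] is feasible for [eta], while each edge contributes at least 4 to [<L, N>];
   hence [4 |E| <= mu (4 e)]. *)
have : inner (laplacian R G) (mu^-1 *: N) <= inner (laplacian R G) M.
  apply: Mmax; first by apply: psdZ => //; rewrite invr_ge0.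
  by apply/diag_of_constP => i; rewrite mxE Nd mulVf // gt_eqF.
rewrite innerZr ler_pdivrMl // => le_inner.
rewrite /e mulrCA -ler_pdivrMl ?invr_gt0 // invrK; apply: le_trans le_inner.
rewrite inner_laplacian // mulr_natr -sumr_const; apply: ler_sum => p Ep.
by have := Nge p Ep; rewrite ler_pdivlMl // mulr1.
Qed.

End Duality.

(** * Edge-transitive graphs: averaging over automorphisms *)

Section EdgeTransitive.
Context {R : realType} {V : finType} (G : sgraph V).

Definition vertex_perm_mx (s : {perm V}) (M : 'M[R]_#|V|) : 'M[R]_#|V| :=
  let f i := enum_rank (s (enum_val i)) in mxsub f f M.

Lemma vertex_perm_mxE s M x y :
  vertex_perm_mx s M (enum_rank x) (enum_rank y) =
  M (enum_rank (s x)) (enum_rank (s y)).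
Proof. by rewrite mxE !enum_rankK. Qed.

Lemma inner_laplacian_perm s M : automorphism G s -> M^T = M ->
  inner (laplacian R G) (vertex_perm_mx s M) = inner (laplacian R G) M.
Proof.
move=> Gs Ms; apply/eqP; rewrite -(eqr_pMn2r (n := 2)) //; apply/eqP.
rewrite !inner_laplacian_pairs //; last by rewrite trmx_mxsub Ms.
rewrite [RHS](reindex_inj (@perm_inj _ s)); apply: eq_bigr => x _ /=.
rewrite [RHS](reindex_inj (@perm_inj _ s)); apply: eq_big => [y|y _] /=.
  by rewrite Gs.
by rewrite /lstar !vertex_perm_mxE.
Qed.

Lemma edge_transitive_eta : edge_transitive G ->
  #|edges G|%:R = eta R G * eta_polar R G.
Proof.
move=> Gtr; have [M [Mp M1 Mmax]] := elliptope_argmax (laplacian R G).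
have [Ms _] := Mp; move/diag_of_constP: M1 => M1.
pose S := [set s : {perm V} | [forall x, forall y, G (s x) (s y) == G x y]].
have SP s : reflect (automorphism G s) (s \in S).
  rewrite inE; apply: (iffP forallP) => [Gs x y|Gs x].
    by have /forallP/(_ y)/eqP := Gs x.
  by apply/forallP => y; rewrite Gs.
have S_neq0 : #|S|%:R != 0 :> R.
  rewrite pnatr_eq0 -lt0n card_gt0; apply/set0Pn; exists 1%g; apply/SP.
  by move=> x y; rewrite !perm1.
pose M' := #|S|%:R^-1 *: \sum_(s in S) vertex_perm_mx s M.
have M'E x y : M' (enum_rank x) (enum_rank y) =
    #|S|%:R^-1 * \sum_(s in S) M (enum_rank (s x)) (enum_rank (s y)).
  rewrite mxE summxE; congr (_ * _); apply: eq_bigr => s _.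
  exact: vertex_perm_mxE.
have M'd i : M' i i = 1.
  rewrite -(enum_valK i) M'E (eq_bigr (fun=> 1)) => [|s _]; last exact: M1.
  by rewrite sumr_const mulVf.
have M'p : psd M'.
  apply: psdZ; first by rewrite invr_ge0.
  by apply: psd_sum => s _; exact: psd_mxsub.
apply: (@eta_mul_polar _ _ _ M'); first split=> //.
- exact/diag_of_constP.
- move=> N Np N1; rewrite innerZr inner_sumr.
  rewrite (eq_bigr (fun=> inner (laplacian R G) M)); last first.
    by move=> s /SP Gs; exact: inner_laplacian_perm.
  by rewrite sumr_const -[X in _ * X]mulr_natl mulKf //; exact: Mmax.
(* Since [s * t] sends [x] to [t (s x)], left translation by [s] permutes the terms of the
   average. *)
have M'aut s x y : automorphism G s ->
    M' (enum_rank (s x)) (enum_rank (s y)) = M' (enum_rank x) (enum_rank y).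
  move=> Gs; rewrite !M'E [in RHS](reindex_inj (mulgI s)); congr (_ * _).
  apply: eq_big => [t|t _]; last by rewrite !permM.
  apply/SP/SP => Gt u v; first by rewrite !permM Gt Gs.
  by have := Gt (s^-1%g u) (s^-1%g v); rewrite -[X in _ = X]Gs !permM !permKV.
move=> [x y] [u v]; rewrite !inE /= => /andP[Gxy _] /andP[Guv _].
rewrite !(lstar_diag _ _ M'd).
(* If [s] reverses the edge, the symmetry of [M'] closes the case. *)
have [s [Gs [[<- <-]|[<- <-]]]] := Gtr _ _ _ _ Gxy Guv; rewrite M'aut //.
by rewrite -{1}M'p.1 mxE.
Qed.

End EdgeTransitive.

(** * Graph distance *)

Section DistanceRegular.
Context {V : finType} (G : sgraph V).

Lemma dist_le_walk x y k : walk G x y k -> (dist G x y <= k)%N.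
Proof.
move=> wk; rewrite leqNgt; apply/negP => kd.
have kV : (k < #|V|)%N.
  by apply: leq_trans kd _; rewrite -[leqRHS](size_iota 0) find_size.
by have := before_find 0%N kd; rewrite nth_iota // wk.
Qed.

(** A path without repeated vertices has fewer than [#|V|] steps, so the bounded search in [dist]
    succeeds. *)
Lemma walk_dist x y : connect G x y -> walk G x y (dist G x y).
Proof.
case/connectP => p /shortenP[q Gq Uq _] ->.
have q_lt : (size q < #|V|)%N.
  by rewrite -[_.+1]/(size (x :: q)) -(card_uniqP Uq) max_card.
have wq : has (walk G x (last x q)) (iota 0 #|V|).
  apply/hasP; exists (size q); first by rewrite mem_iota.
  by apply/existsP; exists (in_tuple q); rewrite Gq eqxx.
have := nth_find 0%N wq; rewrite nth_iota //.
by rewrite -[ltnRHS](size_iota 0) -has_find.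
Qed.

Lemma distxx x : dist G x x = 0%N.
Proof.
apply/eqP; rewrite -leqn0; apply: dist_le_walk.
by apply/existsP; exists [tuple]; rewrite /= eqxx.
Qed.

Hypothesis Gconn : connected_graph G.

Lemma dist_step x y z : G y z -> (dist G x z <= (dist G x y).+1)%N.
Proof.
move=> Gyz; apply: dist_le_walk.
have /existsP[p /andP[Gp /eqP lastp]] := walk_dist (Gconn x y).
by apply/existsP; exists (rcons_tuple p z); rewrite rcons_path Gp last_rcons
  lastp Gyz eqxx.
Qed.

Lemma dist_eq0 x y : (dist G x y == 0%N) = (x == y).
Proof.
apply/eqP/eqP => [d0|->]; last exact: distxx.
have := walk_dist (Gconn x y); rewrite d0 => /existsP[p].
by rewrite (tuple0 p) /= => /eqP.
Qed.

Lemma dist_adj x y : G x y -> dist G x y = 1%N.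
Proof.
move=> Gxy; apply/eqP; rewrite eqn_leq -{1}(distxx x) dist_step //=.
rewrite lt0n dist_eq0; apply/eqP => xy.
by rewrite xy adj_irr in Gxy.
Qed.

End DistanceRegular.

(** * Distance-regular graphs: the least eigenspace *)

Section DistanceRegularEta.
Context {R : realType} {V : finType} (G : sgraph V).

Definition adj_mx : 'M[R]_#|V| :=
  \matrix_(i, j) (G (enum_val i) (enum_val j))%:R.

Lemma trmx_adj_mx : adj_mx^T = adj_mx.
Proof. by apply/matrixP => i j; rewrite !mxE adj_sym. Qed.

Lemma sum_ord_rank (F : 'I_#|V| -> R) : \sum_i F i = \sum_x F (enum_rank x).
Proof. by rewrite (reindex enum_rank) //; exact/onW_bij/enum_rank_bij. Qed.

Lemma sum_indicator (P : pred V) : \sum_x (P x)%:R = #|[pred x | P x]|%:R :> R.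
Proof.
rewrite -sum1_card natr_sum [RHS]big_mkcond; apply: eq_bigr => x _.
by rewrite inE; case: (P x).
Qed.

(** An edge contributes [2 - 2 M_xy], and [tr (A M)] sums [M_xy] over ordered adjacent pairs.
    Maximizing [<L, M>] thus means minimizing [tr (A M)]. *)
Lemma inner_laplacian_adj (M : 'M[R]_#|V|) :
  M^T = M -> (forall i, M i i = 1) ->
  inner (laplacian R G) M = 2 * #|edges G|%:R - \tr (adj_mx *m M).
Proof.
move=> Ms M1; rewrite inner_laplacian //.
rewrite (eq_bigr (fun p : V * V =>
  2 - M (enum_rank p.1) (enum_rank p.2) *+ 2)); last first.
  by move=> p _; rewrite (lstar_diag _ _ M1) mulr1 [2 * M _ _]mulr_natl.
rewrite sumrB sumr_const mulr_natr sumrMnl; congr (_ - _).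
rewrite (sum_edges G (g := fun x y => M (enum_rank x) (enum_rank y))); last first.
  by move=> x y; rewrite -{1}Ms mxE.
rewrite /mxtrace sum_ord_rank; apply: eq_bigr => x _.
rewrite mxE sum_ord_rank big_mkcond; apply: eq_bigr => y _ /=.
rewrite mxE !enum_rankK -{2}Ms mxE.
by case: (G x y); rewrite ?mul1r ?mul0r.
Qed.

(** For a distance-regular graph, this is membership in the Bose-Mesner algebra. *)
Definition dist_mx (M : 'M[R]_#|V|) : Prop :=
  exists f : nat -> R,
    forall x y, M (enum_rank x) (enum_rank y) = f (dist G x y).

Lemma dist_mx_mul_adj M : distance_regular G -> dist_mx M ->
  dist_mx (M *m adj_mx).
Proof.
move=> [Gconn [b [c bcE]]] [f Mf].
(* The neighbours of [z] lie at distance [d + 1], [d - 1] or [d] from [x]. Counting deviations from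
   [f d] avoids the third intersection number [b 0 - b d - c d]; at [d = 0] the factor [c 0] is
   zero. *)
exists (fun d => (b d)%:R * (f d.+1 - f d) + (c d)%:R * (f d.-1 - f d)
  + (b 0)%:R * f d) => x z.
set d := dist G x z.
have [bE cE] := bcE x z.
have deg : #|[pred y | G z y]| = b 0%N.
  have [+ _] := bcE z z; rewrite distxx => <-; apply: eq_card => y; rewrite !inE.
  by case Gzy: (G z y) => //=; rewrite (dist_adj Gconn Gzy).
rewrite mxE sum_ord_rank -bE -cE -deg -!sum_indicator !mulr_suml -!big_split /=.
apply: eq_bigr => y _; rewrite Mf mxE !enum_rankK adj_sym -/d.
case Gzy: (G z y) => /=; last by rewrite !mul0r mulr0 !addr0.
have Gyz : G y z by rewrite adj_sym.
(* The sums are compared neighbour by neighbour, in these three cases. *)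
have := dist_step Gconn x Gzy; rewrite -/d leq_eqVlt ltnS => /predU1P[->|le_d].
  by rewrite eqxx (gtn_eqF (leqnSn _)) !mul0r !mul1r mulr1; ring.
have := dist_step Gconn x Gyz; rewrite -/d leq_eqVlt ltnS => /predU1P[->|ge_d].
  by rewrite eqxx (ltn_eqF (leqnSn _)) /= !mul0r !mul1r mulr1; ring.
have -> : dist G x y = d by apply/eqP; rewrite eqn_leq le_d ge_d.
by rewrite ltn_eqF // gtn_eqF // !mul0r mul1r mulr1 !add0r.
Qed.

Lemma distance_regular_eta : distance_regular G ->
  #|edges G|%:R = eta R G * eta_polar R G.
Proof.
move=> Gdr; have [Gconn _] := Gdr.
(* The empty graph has no eigenvalue, but is vacuously edge-transitive. *)
have [V0|V_gt0] := posnP #|V|.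
  apply: edge_transitive_eta => x.
  by have := fintype0 x V0.
have [|||theta [P [[f Pf] Pp [i0 Pi0] Bp AP]]] :=
    @least_eigenspace_psd _ _ adj_mx dist_mx V_gt0 trmx_adj_mx.
- move=> a; exists (fun d => a *+ (d == 0%N)) => x y.
  by rewrite mxE (inj_eq enum_rank_inj) dist_eq0.
- move=> X Y [f Xf] [g Yg]; exists (fun d => f d + g d) => x y.
  by rewrite mxE Xf Yg.
- by move=> X; exact: dist_mx_mul_adj.
(* The diagonal of [P] is constant, so one positive entry allows rescaling it to 1. *)
have Pd i : P i i = f 0%N by rewrite -(enum_valK i) Pf distxx.
rewrite Pd in Pi0; have f0 : f 0%N != 0 by rewrite gt_eqF.
pose M := (f 0%N)^-1 *: P.
have Md i : M i i = 1 by rewrite mxE Pd mulVf.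
have Mp : psd M by apply: psdZ => //; rewrite invr_ge0 ltW.
have tr1 (N : 'M[R]_#|V|) : (forall i, N i i = 1) -> \tr N = #|V|%:R.
  by move=> N1; rewrite /mxtrace (eq_bigr (fun=> 1)) // sumr_const card_ord.
apply: (@eta_mul_polar _ _ _ M); first split=> //.
- exact/diag_of_constP.
- move=> N Np /diag_of_constP N1.
  rewrite !inner_laplacian_adj //; [|exact: Mp.1|exact: Np.1].
  rewrite lerD2l lerN2.
  (* [A M = theta M], and [M] and [N] have the same trace [#|V|]; what remains is
     [tr ((A - theta) N) >= 0]. *)
  have -> : \tr (adj_mx *m M) = theta * \tr N.
    by rewrite -scalemxAr AP !mxtraceZ mulrCA -mxtraceZ (tr1 M) // (tr1 N).
  have := psd_tr_mul_ge0 Bp Np.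
  by rewrite mulmxBl linearB /= mul_scalar_mx mxtraceZ subr_ge0.
move=> [x y] [u v]; rewrite !inE /= => /andP[Gxy _] /andP[Guv _].
by rewrite !(lstar_diag _ _ Md) ![M _ _]mxE !Pf !dist_adj.
Qed.

End DistanceRegularEta.

Theorem corollary4 (R : realType) (V : finType) (G : sgraph V) :
  edge_transitive G \/ distance_regular G ->
  #|edges G|%:R = eta R G * eta_polar R G.
Proof.
by case; [exact: edge_transitive_eta | exact: distance_regular_eta].
Qed.
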